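(* Let $X, Y$ be topological spaces and let $f : X \to Y$ be a globally multi-split continuous surjection. If $X$ is compact, then $Y$ is compact.
   Context: Compact means that every open cover has a finite subcover (no separation axiom is included). A neighborhood of a point $p$ (respectively of a subset $S$) in a topological space is a set $V$, not necessarily open, for which there is an open set $U$ with $p \in U \subseteq V$ (respectively $S \subseteq U \subseteq V$). Let $f : X \to Y$ be a function between topological spaces and $p \in X$. The function $f$ is multi-split continuous at $p$ if there exists a finite non-empty set $Z_p \subseteq Y$ such that: (a) for every $y \in Z_p$ and all neighborhoods $U \subseteq X$ of $p$ and $V \subseteq Y$ of $y$ one has $f(U) \cap V \neq \varnothing$; (b) for every neighborhood $V \subseteq Y$ of the set $Z_p$ there exists a neighborhood $U \subseteq X$ of $p$ with $f(U) \subseteq V$. The function $f$ is globally multi-split continuous if it is multi-split continuous at every $p \in X$. *)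

(* Defs.v *)
From mathcomp Require Import all_boot all_classical all_analysis.

Set Implicit Arguments.
Unset Strict Implicit.
Unset Printing Implicit Defensive.

Local Open Scope classical_set_scope.

(* Neighborhoods need not be open: by [nbhsE] and [set_nbhsP], membership in
   [nbhs y] or [set_nbhs Z] means containing an open set that contains [y]
   or includes [Z], respectively. *)
Definition multisplit_continuous_at (X Y : topologicalType) (f : X -> Y)
    (p : X) : Prop :=
  exists Z : set Y,
    [/\ finite_set Z,
        Z !=set0,
        forall (y : Y) (U : set X) (V : set Y),
          Z y -> nbhs p U -> nbhs y V -> (f @` U) `&` V !=set0
      & forall V : set Y, set_nbhs Z V ->
          exists2 U : set X, nbhs p U & f @` U `<=` V].

Definition globally_multisplit_continuous (X Y : topologicalType)
    (f : X -> Y) : Prop :=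
  forall p : X, multisplit_continuous_at f p.

(* Main.v *)
Require Import Defs.
From mathcomp Require Import all_boot all_classical all_analysis.
From mathcomp Require Import finmap.

(** Let [F] be an open cover of [Y].  The finite set [Z] witnessing
    multi-split continuity at [p] is contained in the union of finitely many
    members of [F]; that union is open, hence a neighborhood of [Z], so some
    neighborhood of [p] has its image inside it
    ([multisplit_locally_finite_cover]).  Shrunk to be open, these
    neighborhoods cover the compact space [X]; finitely many of them suffice,
    and by surjectivity their images exhaust [Y].  Each image needs only
    finitely many members of [F], so [Y] does too
    ([finite_subset_cover_bigcup]).

    Thus multi-split continuity acts as a local smallness condition: the image
    of a small neighborhood is controlled by finitely many open sets, where for
    a continuous map it would be controlled by a single one. *)

Local Open Scope classical_set_scope.

(** This serves twice: over the points of a witness [Z], where each singleton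
    needs one member of the cover, and over a finite subcover of the domain. *)
Lemma finite_subset_cover_bigcup (I : choiceType) (D : set I) (J T : Type)
    (F : I -> set T) (A : set J) (B : J -> set T) :
  finite_set A -> (forall a, A a -> finite_subset_cover D F (B a)) ->
  finite_subset_cover D F (\bigcup_(a in A) B a).
Proof.
move=> finA coverB.
have /choice[E EP] a : exists E : {fset I},
    A a -> {subset E <= D} /\ B a `<=` cover [set` E] F.
  have [/coverB[E ED BE]|nAa] := pselect (A a); first by exists E.
  (* Outside [A] any value of [E] will do. *)
  by exists fset0.
have : finite_set (\bigcup_(a in A) [set` E a]) by exact: bigcup_finite.
move=> /finite_fsetP[G GE]; exists G => [i iG|y [a Aa Bay]].
  have [a Aa iEa] : (\bigcup_(a in A) [set` E a]) i by rewrite GE.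
  by have [ED _] := EP a Aa; exact: ED.
have [_ /(_ y Bay)[i iEa Fiy]] := EP a Aa; exists i => //.
by rewrite -GE; exists a.
Qed.

Lemma finite_set_finite_subset_cover (I : choiceType) (D : set I) (T : Type)
    (F : I -> set T) (A : set T) :
  finite_set A -> A `<=` cover D F -> finite_subset_cover D F A.
Proof.
move=> finA AF.
have -> : A = \bigcup_(y in A) [set y].
  by apply/seteqP; split=> [y Ay|y [z Az ->]] //; exists y.
apply: finite_subset_cover_bigcup => // y /AF[i Di Fiy].
exists [fset i]%fset => [j|_ ->]; first by move=> /fset1P ->; exact: mem_set.
by exists i => //=; rewrite inE.
Qed.

(** The neighborhood of [Z] fed to multi-split continuity is the union of a
    finite subfamily covering [Z]; it is open because its members are. *)
Lemma multisplit_locally_finite_cover (X Y : topologicalType) (f : X -> Y)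
    (p : X) (I : choiceType) (D : set I) (F : I -> set Y) :
  multisplit_continuous_at f p ->
  (forall i, D i -> open (F i)) -> [set: Y] `<=` cover D F ->
  exists2 U : set X, nbhs p U & finite_subset_cover D F (f @` U).
Proof.
move=> [Z [finZ _ _ Z_image]] openF coverF.
have [E ED ZE] : finite_subset_cover D F Z.
  by apply: finite_set_finite_subset_cover => // y _; exact: coverF.
have openE : open (cover [set` E] F).
  by apply: bigcup_open => i /ED /set_mem; exact: openF.
have [|U pU fUE] := Z_image (cover [set` E] F); last by exists U => //; exists E.
by move=> y /ZE Ey; exact: open_nbhs_nbhs.
Qed.

Theorem proposition6p6 (X Y : topologicalType) (f : X -> Y)
  (f_multisplit : globally_multisplit_continuous f)
  (f_surj : set_surj [set: X] [set: Y] f)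
  (X_compact : cover_compact [set: X]) :
  cover_compact [set: Y].
Proof.
move=> I D F openF coverF.
have /choice[U UP] (p : X) : exists V : set X,
    nbhs p V /\ finite_subset_cover D F (f @` V).
  have [V pV fV] :=
    multisplit_locally_finite_cover _ _ _ _ _ _ _ (f_multisplit p) openF coverF.
  by exists V.
have [p _|p _|P _ XP] := X_compact X setT (fun p => (U p)°).
- exact: open_interior.
- by exists p => //; have [] := UP p.
have [E ED PE] : finite_subset_cover D F (\bigcup_(p in [set` P]) (f @` U p)).
  by apply: finite_subset_cover_bigcup => // p _; have [] := UP p.
exists E => // y _; apply: PE.
have [x _ <-] := f_surj y Logic.I.
have [p Pp Upx] := XP x Logic.I.
by exists p => //; exists x => //; exact: interior_subset.
Qed.
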